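(* Let $A=(a_{i,j})$ be an $n\times n$ matrix with entries in $\mathbb{Z}_{\ge 0}\cup\{-\infty\}$. Suppose that $\operatorname{tdet}(A)=\sum_{i=1}^n a_{i,i}$. If $\tau\in S_n$ is a cycle, then $$a_{\tau}\le\sum_{i\in\operatorname{supp}(\tau)}a_{i,i}.$$
   Context: $\operatorname{tdet}(A)=\max_{\rho\in S_n}\sum_{i=1}^n a_{i,\rho(i)}$ is the tropical determinant, with the convention $-\infty+a=-\infty$. For a cycle $\tau=(i_1\,i_2\,\ldots\,i_s)\in S_n$, $a_{\tau}=a_{i_1,i_2}+a_{i_2,i_3}+\cdots+a_{i_s,i_1}$. The support $\operatorname{supp}(\tau)$ is the set of elements of $\{1,\ldots,n\}$ not fixed by $\tau$.
   Formalization: The tropical determinant tdet(A) is assumed to be different from −∞ (without this the claim fails, e.g. when a row outside supp(τ) is all −∞), and cycles are taken to have length at least 2. *)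

(* Defs.v *)
From HB Require Import structures.
From mathcomp Require Import all_boot all_order all_algebra all_fingroup.
From mathcomp Require Import constructive_ereal.

Set Implicit Arguments.
Unset Strict Implicit.
Unset Printing Implicit Defensive.

Import Order.TTheory GRing.Theory Num.Theory.

Local Open Scope ring_scope.
Local Open Scope ereal_scope.

(* Tropical scalars live in [\bar int], whose addition satisfies
   -oo + x = -oo for every x; [nneg_or_ninfty] carves out
   Z_{>=0} together with -oo, and in particular excludes +oo. *)
Definition nneg_or_ninfty (x : \bar int) : Prop :=
  x = -oo \/ exists k : nat, x = (k%:Z)%:E.

Definition tdet (n : nat) (A : 'M[\bar int]_n) : \bar int :=
  \big[Order.max/-oo]_(rho : 'S_n) \sum_(i < n) A i (rho i).

(* tau = (i_1 i_2 ... i_s) with s = [:: i_1; ...; i_s]; [next s i] is i itself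
   when i is not in s. Cycles have length at least 2: the identity is not a
   cycle, since its one-element notations (i_1) would give it several values
   of a_tau. *)
Definition is_cycle (n : nat) (tau : 'S_n) (s : seq 'I_n) : Prop :=
  [/\ (1 < size s)%N, uniq s & forall i, tau i = next s i].

(* a_{i_1,i_2} + a_{i_2,i_3} + ... + a_{i_s,i_1} *)
Definition cycle_weight (n : nat) (A : 'M[\bar int]_n) (s : seq 'I_n) :
    \bar int :=
  \sum_(p <- zip s (rot 1 s)) A p.1 p.2.

Definition perm_supp (n : nat) (tau : 'S_n) : {set 'I_n} :=
  [set i | tau i != i].

(* Main.v *)
Require Import Defs.
From HB Require Import structures.
From mathcomp Require Import all_boot all_order all_algebra all_fingroup.
From mathcomp Require Import constructive_ereal.

(** The weight of the permutation [tau] is at most [tdet A], hence at most the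
    weight of the identity. These two sums have the same terms at the fixed
    points of [tau]; since the tropical determinant is finite, so is every
    diagonal entry, and the common part can be cancelled. What remains on the
    left is the sum of the [A i (tau i)] over the support of [tau], which is
    the weight of the cycle because the support consists of the entries of
    [s]. *)

Set Implicit Arguments.
Unset Strict Implicit.
Unset Printing Implicit Defensive.

Import Order.TTheory GRing.Theory Num.Theory.

Local Open Scope ring_scope.
Local Open Scope ereal_scope.

Lemma zip_rot1_next (T : eqType) (s : seq T) :
  uniq s -> zip s (rot 1 s) = [seq (i, next s i) | i <- s].
Proof.
case: s => [//|x p] us; rewrite rot1_cons.
apply: (@eq_from_nth _ (x, x)) => [|k].
  by rewrite size_zip size_rcons minnn size_map.
rewrite size_zip size_rcons minnn => lt_k.
rewrite nth_zip ?size_rcons // (nth_map x) // next_nth mem_nth //.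
(* The last entry is followed by [x]: the final item of [rot 1 s] on one side,
   the out-of-range default used by [next_nth] on the other. *)
by rewrite index_uniq // nth_rcons_default.
Qed.

(** The successor function is invariant under rotation of a duplicate-free
    sequence, so [i] may be moved to the front, where its successor is the
    second entry. *)
Lemma next_neq (T : eqType) (s : seq T) (i : T) :
  uniq s -> (1 < size s)%N -> i \in s -> next s i != i.
Proof.
move=> us lt1s /rot_to[k t def_t]; rewrite -(next_rot k us) def_t.
have : uniq (i :: t) by rewrite -def_t rot_uniq.
have : (1 < size (i :: t))%N by rewrite -def_t size_rot.
by case: t {def_t} => [//|y t] _ /=; rewrite eqxx inE eq_sym => /andP[/norP[]].
Qed.

Lemma perm_supp_cycle (n : nat) (tau : 'S_n) (s : seq 'I_n) :
  is_cycle tau s -> perm_supp tau =i s.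
Proof.
case=> lt1s us tauE i; rewrite inE tauE.
have [s_i|s'i] := boolP (i \in s); first exact: next_neq.
by rewrite next_nth (negPf s'i) eqxx.
Qed.

Lemma cycle_weight_supp (n : nat) (A : 'M[\bar int]_n) (tau : 'S_n)
    (s : seq 'I_n) :
  is_cycle tau s ->
  cycle_weight A s = \sum_(i in perm_supp tau) A i (tau i).
Proof.
move=> cyc; have [_ us tauE] := cyc.
rewrite /cycle_weight zip_rot1_next // big_map big_uniq //=.
apply: eq_big => [i|i _]; last by rewrite tauE.
by rewrite (perm_supp_cycle cyc).
Qed.

Lemma sum_perm_le_tdet (n : nat) (A : 'M[\bar int]_n) (rho : 'S_n) :
  \sum_(i < n) A i (rho i) <= tdet A.
Proof. exact: (le_bigmax _ (fun rho : 'S_n => \sum_(i < n) A i (rho i))). Qed.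

(** [-oo] absorbs every summand, so a single infinite diagonal entry would
    make the whole diagonal sum infinite. *)
Lemma diag_fin_num (n : nat) (A : 'M[\bar int]_n) (i : 'I_n) :
  (forall i j, nneg_or_ninfty (A i j)) -> \sum_(j < n) A j j <> -oo ->
  A i i \is a fin_num.
Proof.
move=> hA hsum; case: (hA i i) => [Aii|[k ->] //].
by case: hsum; rewrite (bigD1 i) //= Aii addNye.
Qed.

Theorem lemma4p7 (n : nat) (A : 'M[\bar int]_n)
    (hA : forall i j, nneg_or_ninfty (A i j))
    (hfin : tdet A <> -oo)
    (hdiag : tdet A = \sum_(i < n) A i i)
    (tau : 'S_n) (s : seq 'I_n) (htau : is_cycle tau s) :
  cycle_weight A s <= \sum_(i in perm_supp tau) A i i.
Proof.
rewrite (cycle_weight_supp A htau).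
have := sum_perm_le_tdet A tau; rewrite hdiag.
rewrite (bigID (mem (perm_supp tau))) /=.
rewrite [in leRHS](bigID (mem (perm_supp tau))) /=.
have -> : \sum_(i | i \notin perm_supp tau) A i (tau i) =
          \sum_(i | i \notin perm_supp tau) A i i.
  by apply: eq_bigr => i; rewrite inE negbK => /eqP->.
rewrite leeD2rE //; apply/sum_fin_numP => i _ _.
by apply: diag_fin_num; rewrite -?hdiag.
Qed.
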